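(* Let $m>1$ be an integer and let $T(N)=\{(x,y)\in\mathbb{Z}^2\mid |x|,|y|<N,\ y^2-4x^m<0,\ \gcd(x,y)=1\}$. Then for all but $O(N^{\frac32}\log N)$ elements $(x,y)\in T(N)$, the ideal class group of $\mathbb{Q}\left(\sqrt{y^2-4x^m}\right)$ has an element of order $m$. *)

(* Defs.v *)
From HB Require Import structures.
From mathcomp Require Import all_boot all_order all_algebra all_field.
From mathcomp Require Import finmap.
From mathcomp Require Import all_classical all_reals all_analysis.
Import Order.TTheory GRing.Theory Num.Theory.
Import numFieldNormedType.Exports.

Set Implicit Arguments.
Unset Strict Implicit.
Unset Printing Implicit Defensive.

Local Open Scope classical_set_scope.
Local Open Scope ring_scope.

(* Number fields are taken as subfields K of algC, given by their set of
   elements; Aint is the ring of all algebraic integers. *)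

Definition ring_of_integers (K : set algC) : set algC :=
  [set z | K z /\ z \in Aint].

(* Nonzero O_K-submodules I of K such that b I is contained in O_K for some
   nonzero b in O_K. *)
Definition fractional_ideal (K : set algC) : set (set algC) :=
  [set I | [/\ I `<=` K,
               exists2 x, I x & x != 0,
               (forall x y, I x -> I y -> I (x - y)),
               (forall a x, ring_of_integers K a -> I x -> I (a * x))
             & exists b, [/\ ring_of_integers K b, b != 0 &
                 forall x, I x -> ring_of_integers K (b * x)]]].

Definition scale_ideal (a : algC) (I : set algC) : set algC :=
  [set a * x | x in I].

Definition ideal_mul (I J : set algC) : set algC :=
  [set z | exists n (u v : 'I_n -> algC),
     [/\ forall i, I (u i), forall i, J (v i) & z = \sum_(i < n) u i * v i]].

(* The coset of I modulo the principal fractional ideals. *)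
Definition ideal_class (K I : set algC) : set (set algC) :=
  [set J | exists a, [/\ K a, a != 0 & J = scale_ideal a I]].

Definition class_group (K : set algC) : set (set (set algC)) :=
  [set ideal_class K I | I in fractional_ideal K].

Definition class_one (K : set algC) : set (set algC) :=
  ideal_class K (ring_of_integers K).

(* As in any abelian quotient group, the product of two cosets is the set of
   the products of their elements; see ideal_classM. *)
Definition class_mul (c1 c2 : set (set algC)) : set (set algC) :=
  [set L | exists I J, [/\ c1 I, c2 J & L = ideal_mul I J]].

Definition class_exp (K : set algC) (c : set (set algC)) (n : nat) :
    set (set algC) :=
  iter n (class_mul c) (class_one K).

Definition class_has_order (K : set algC) (c : set (set algC)) (n : nat) :
    Prop :=
  [/\ (0 < n)%N,
      class_exp K c n = class_one K
    & forall k : nat, (0 < k < n)%N -> class_exp K c k <> class_one K].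

Definition has_class_of_order (K : set algC) (n : nat) : Prop :=
  exists2 c, class_group K c & class_has_order K c n.

Definition Qsqrt (d : int) : set algC :=
  [set z | exists a b : rat, z = ratr a + ratr b * sqrtC d%:~R].

Definition radicand (m : nat) (p : int * int) : int := p.2 ^+ 2 - 4 * p.1 ^+ m.

Definition T (m N : nat) : set (int * int) :=
  [set p | [/\ `|p.1| < N%:Z, `|p.2| < N%:Z, radicand m p < 0
             & gcdz p.1 p.2 = 1]].

Definition exceptional (m N : nat) : set (int * int) :=
  [set p | T m N p /\ ~ has_class_of_order (Qsqrt (radicand m p)) m].

(* Since T m N is finite, the cardinal #|` fset_set (exceptional m N)| is the
   actual number of exceptional pairs (fset_set is the empty set on infinite
   sets). *)
Lemma finite_T (m N : nat) : finite_set (T m N).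
Proof.
pose f (p : nat * nat) : int * int := (p.1%:Z - N%:Z, p.2%:Z - N%:Z).
apply: (@sub_finite_set _ _ (f @` (`I_(2 * N) `*` `I_(2 * N)))); last first.
  by apply: finite_image; apply: finite_setX; apply: finite_II.
have shift (x : int) : `|x| < N%:Z ->
    exists2 k, (k < 2 * N)%N & k%:Z - N%:Z = x.
  rewrite ltr_norml => /andP[lo hi].
  have ge0 : 0 <= x + N%:Z by rewrite -lerBlDr sub0r ltW.
  exists (absz (x + N%:Z)); last by rewrite gez0_abs // addrK.
  by rewrite -ltz_nat gez0_abs // mul2n -addnn PoszD ltrD2r.
move=> [x y] [/= /shift[i ltiN <-] /shift[j ltjN <-] _ _].
by exists (i, j).
Qed.

Lemma finite_exceptional (m N : nat) : finite_set (exceptional m N).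
Proof. by apply: sub_finite_set (finite_T m N) => p []. Qed.

Lemma ideal_mul_scale (a b : algC) (I J : set algC) :
  ideal_mul (scale_ideal a I) (scale_ideal b J) =
  scale_ideal (a * b) (ideal_mul I J).
Proof.
apply/seteqP; split=> z /=.
- move=> [n [u [v [Iu Jv ->]]]].
  pose u' i := sval (cid2 (Iu i)); pose v' i := sval (cid2 (Jv i)).
  exists (\sum_(i < n) u' i * v' i).
    by exists n, u', v'; split=> // i; rewrite /u' /v'; case: cid2.
  rewrite mulr_sumr; apply: eq_bigr => i _.
  rewrite /u' /v'; case: cid2 => x _ /= <-; case: cid2 => y _ /= <-.
  by rewrite mulrACA.
- move=> [_ [n [u [v [Iu Jv ->]]]] <-].
  exists n, (fun i => a * u i), (fun i => b * v i); split=> [i|i|].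
  + by exists (u i).
  + by exists (v i).
  + by rewrite mulr_sumr; apply: eq_bigr => i _; rewrite mulrACA.
Qed.

Lemma ideal_classM (K I J : set algC) : K 1 ->
  (forall a b, K a -> K b -> K (a * b)) ->
  class_mul (ideal_class K I) (ideal_class K J) = ideal_class K (ideal_mul I J).
Proof.
move=> K1 KM; apply/seteqP; split=> L /=.
- move=> [_ [_ [[a [Ka a0 ->]] [b [Kb b0 ->]] ->]]].
  by exists (a * b); rewrite mulf_neq0 // ideal_mul_scale; split=> //; exact: KM.
- move=> [a [Ka a0 ->]].
  exists (scale_ideal a I), (scale_ideal 1 J); split; [by exists a| |].
  + by exists 1; rewrite oner_neq0.
  + by rewrite ideal_mul_scale mulr1.
Qed.

(* Main.v *)
(** Put d = y^2 - 4x^m, theta = (y + sqrt d)/2 and I = (x, theta) in the ring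
    of integers of Q(sqrt d).  As theta and its conjugate are comaximal with
    product x^m, I^m = (theta).  If the class of I does not have order m, then
    I^k is principal for a proper divisor k of m, so theta = z a^e with z a
    unit, e = m/k >= 2 and |a|^2 = |x|^k.
    - If z = 1 or -1, then y is up to sign the value at the integer trace of a
      of the Dickson polynomial of degree e and parameter |x|^k.  That
      polynomial is monic of degree at least 2, so it has absolute value less
      than N at O(sqrt N) integers only.
    - Otherwise the field contains a nonreal unit and has class number one, so
      one may take k = 1; then |a|^2 = |x| < N, which leaves O(sqrt N)
      possibilities for the trace of a, and boundedly many for z.
    Hence each x carries O(sqrt N) exceptional y, which gives O(N^(3/2)) pairs
    in total. *)

Require Import Defs.
From HB Require Import structures.
From mathcomp Require Import all_boot all_order all_algebra all_field.
From mathcomp Require Import finmap.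
From mathcomp Require Import all_classical all_reals all_analysis.
From mathcomp Require Import ring lra zify.
Import Order.TTheory GRing.Theory Num.Theory.
Import numFieldNormedType.Exports.

Local Open Scope classical_set_scope.
Local Open Scope ring_scope.

(** The form is the norm of [e + f * zeta] for [zeta] of trace [t] and norm 1. Each of its three
    terms is at most 1/4. *)
Lemma binary_form_lt1 (F : realFieldType) (t e f : F) :
  `|t| <= 1 -> `|e| <= 2^-1 -> `|f| <= 2^-1 -> e ^+ 2 + t * e * f + f ^+ 2 < 1.
Proof.
move=> ht he hf.
have sqr_le (x : F) : `|x| <= 2^-1 -> x ^+ 2 <= 2^-1 * 2^-1.
  by move=> hx; rewrite -real_normK ?num_real // expr2; exact: ler_pM.
have hef : t * e * f <= 1 * 2^-1 * 2^-1.
  apply: le_trans (ler_norm _) _; rewrite !normrM.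
  by apply: ler_pM (ler_pM _ _ ht he) hf; rewrite ?mulr_ge0.
have := sqr_le _ he; have := sqr_le _ hf; lra.
Qed.

(** * Ideals of imaginary quadratic fields *)

Section ImaginaryQuadratic.

Variable d : int.
Hypothesis d_lt0 : d < 0.

Local Notation K := (Qsqrt d).
Local Notation O := (ring_of_integers K).
Local Notation s := (sqrtC (d%:~R : algC)).

Lemma sqr_sqrtd : s ^+ 2 = d%:~R.
Proof. exact: sqrtCK. Qed.

(** Conjugation preserves the square [d], so it fixes or negates [s]. A fixed [s] would be real,
    with a nonnegative square. *)
Lemma conj_sqrtd : s^* = - s.
Proof.
have : (s^*) ^+ 2 == s ^+ 2.
  by rewrite -rmorphXn sqr_sqrtd /= rmorph_int.
rewrite eqf_sqr => /orP[/eqP sR|/eqP //].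
have : 0 <= s ^+ 2 by rewrite real_exprn_even_ge0 // CrealE sR.
by rewrite sqr_sqrtd ler0z leNgt d_lt0.
Qed.

Lemma Qsqrt_ratr (a : rat) : K (ratr a).
Proof. by exists a, 0; rewrite rmorph0 mul0r addr0. Qed.

Lemma Qsqrt1 : K 1.
Proof. by have := Qsqrt_ratr 1; rewrite rmorph1. Qed.

Lemma QsqrtD (u v : algC) : K u -> K v -> K (u + v).
Proof.
move=> [a [b ->]] [a' [b' ->]]; exists (a + a'), (b + b').
by rewrite !rmorphD /=; ring.
Qed.

Lemma QsqrtM (u v : algC) : K u -> K v -> K (u * v).
Proof.
move=> [a [b ->]] [a' [b' ->]].
exists (a * a' + b * b' * d%:~R), (a * b' + a' * b).
have := sqr_sqrtd; move: s => t td.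
rewrite !(rmorphD, rmorphM) /= ratr_int -td; ring.
Qed.

Lemma QsqrtX (u : algC) n : K u -> K (u ^+ n).
Proof.
move=> Ku; elim: n => [|n IH]; rewrite ?expr0 ?exprS; first exact: Qsqrt1.
exact: QsqrtM.
Qed.

Lemma QsqrtN (u : algC) : K u -> K (- u).
Proof.
move=> Ku; rewrite -mulN1r; apply: QsqrtM => //.
by rewrite -[X in K X](rmorphN1 (ratr : rat -> algC)); exact: Qsqrt_ratr.
Qed.

Lemma conj_ratr (a : rat) : (ratr a : algC)^* = ratr a.
Proof. by rewrite conj_Crat // Crat_rat. Qed.

Lemma conj_Qsqrt (a b : rat) :
  (ratr a + ratr b * s)^* = ratr a - ratr b * s :> algC.
Proof.
rewrite rmorphD /= conj_ratr [X in _ + X]rmorphM /= conj_ratr conj_sqrtd.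
by rewrite mulrN.
Qed.

Lemma Qsqrt_conj (u : algC) : K u -> K (u^*).
Proof.
by move=> [a [b ->]]; exists a, (- b); rewrite conj_Qsqrt rmorphN mulNr.
Qed.

Lemma Qsqrt_trace (u : algC) : K u -> u + u^* \in Crat.
Proof.
move=> [a [b ->]]; rewrite conj_Qsqrt; apply/CratP; exists (a + a).
by rewrite rmorphD /=; ring.
Qed.

Lemma Qsqrt_normE (u : algC) : K u ->
  exists q : rat, u * u^* = ratr q.
Proof.
move=> [a [b ->]]; rewrite conj_Qsqrt; exists (a ^+ 2 - b ^+ 2 * d%:~R).
have := sqr_sqrtd; move: s => t td.
by rewrite !(rmorphB, rmorphM, rmorphXn) /= ratr_int -td; ring.
Qed.

Lemma QsqrtV (u : algC) : K u -> K u^-1.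
Proof.
move=> Ku; have [->|u0] := eqVneq u 0.
  by rewrite invr0; have := Qsqrt_ratr 0; rewrite rmorph0.
have [q uq] := Qsqrt_normE u Ku.
have -> : u^-1 = u^* * ratr q^-1.
  rewrite fmorphV /= -uq invfM [u^* * _]mulrC -mulrA mulVf ?mulr1 //.
  by rewrite fmorph_eq0.
by apply: QsqrtM; [exact: Qsqrt_conj|exact: Qsqrt_ratr].
Qed.

(** * Integers of the field: traces, norms and units *)

Lemma intring1 : O 1.
Proof. by split; [exact: Qsqrt1|exact: Aint1]. Qed.

Lemma intringD u v : O u -> O v -> O (u + v).
Proof. by move=> [? ?] [? ?]; split; [exact: QsqrtD|exact: rpredD]. Qed.

Lemma intringM u v : O u -> O v -> O (u * v).
Proof. by move=> [? ?] [? ?]; split; [exact: QsqrtM|exact: rpredM]. Qed.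

Lemma intringN u : O u -> O (- u).
Proof. by move=> [? ?]; split; [exact: QsqrtN|rewrite rpredN]. Qed.

Lemma intringX u n : O u -> O (u ^+ n).
Proof. by move=> [? ?]; split; [exact: QsqrtX|exact: rpredX]. Qed.

Lemma intring_conj u : O u -> O (u^*).
Proof. by move=> [? ?]; split; [exact: Qsqrt_conj|rewrite Aint_aut]. Qed.

Lemma intring_int (n : int) : O n%:~R.
Proof.
split; last exact: Aint_int.
by rewrite -[n%:~R](ratr_int algC); exact: Qsqrt_ratr.
Qed.

Lemma intring0 : O 0.
Proof. exact: (intring_int 0). Qed.

(** The trace is rational and an algebraic integer, hence an integer. *)
Lemma intring_trace u : O u -> exists t : int, u + u^* = t%:~R.
Proof.
move=> Ou; have [[Ku _] [_ Au']] := (Ou, intring_conj _ Ou).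
apply/intrP/Cint_rat_Aint; first exact: Qsqrt_trace.
by apply: rpredD; last exact: Au'; case: Ou.
Qed.

Lemma intring_norm u : O u -> exists n : nat, u * u^* = n%:R.
Proof.
move=> Ou; have [[Ku _] [_ Au']] := (Ou, intring_conj _ Ou).
apply/natrP; rewrite natrEint mul_conjC_ge0 andbT.
apply: Cint_rat_Aint.
  by have [q ->] := Qsqrt_normE u Ku; rewrite Crat_rat.
by apply: rpredM; last exact: Au'; case: Ou.
Qed.

(** The norms of [u] and [u^-1] are natural numbers with product 1. *)
Lemma intring_unit_norm u : u != 0 -> O u -> O u^-1 -> u * u^* = 1.
Proof.
move=> u0 Ou OuV; have [n nE] := intring_norm _ Ou.
have [n' n'E] := intring_norm _ OuV.
have : n%:R * n'%:R == 1 :> algC.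
  by rewrite -nE -n'E mulrACA -rmorphM /= divff // rmorph1 mulr1.
rewrite -natrM -[1]/(1%:R) eqr_nat muln_eq1 => /andP[/eqP n1 _].
by rewrite nE n1.
Qed.

(** * Scaled ideals and exponents that make a power principal *)

Lemma scale_idealA (a b : algC) (J : set algC) :
  scale_ideal a (scale_ideal b J) = scale_ideal (a * b) J.
Proof.
apply/seteqP; split => z.
  by move=> [_ [w Jw <-] <-]; exists w => //; rewrite mulrA.
by move=> [w Jw <-]; exists (b * w); [exists w|rewrite mulrA].
Qed.

Lemma scale_ideal1 (J : set algC) : scale_ideal 1 J = J.
Proof.
apply/seteqP; split => z; first by move=> [w Jw <-]; rewrite mul1r.
by move=> Jz; exists z => //; rewrite mul1r.
Qed.

Lemma scale_ideal_eq (a b : algC) (I J : set algC) : a != 0 ->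
  scale_ideal a I = scale_ideal b J -> I = scale_ideal (b / a) J.
Proof.
move=> a0 /(congr1 (scale_ideal a^-1)).
by rewrite !scale_idealA mulVf // scale_ideal1 mulrC.
Qed.

Lemma ideal_class_oneP (I : set algC) :
  ideal_class K I = class_one K <->
  exists a, [/\ K a, a != 0 & I = scale_ideal a O].
Proof.
split=> [IE|[a [Ka a0 ->]]].
  have : ideal_class K I I.
    by exists 1; rewrite oner_neq0 scale_ideal1; split=> //; exact: Qsqrt1.
  by rewrite IE.
apply/seteqP; split => L [b [Kb b0 ->]].
  exists (b * a); rewrite mulf_neq0 // scale_idealA; split=> //.
  exact: QsqrtM.
exists (b / a); rewrite mulf_neq0 ?invr_eq0 // scale_idealA mulfVK //.
by split=> //; apply: QsqrtM => //; exact: QsqrtV.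
Qed.

Local Notation "I ^^ n" := (iter n (ideal_mul I) O) (at level 29).

Lemma class_exp_ideal (I : set algC) n :
  class_exp K (ideal_class K I) n = ideal_class K (I ^^ n).
Proof.
elim: n => [//|n IH]; rewrite /class_exp iterS -/(class_exp _ _ n) IH.
by rewrite ideal_classM //; [exact: Qsqrt1|exact: QsqrtM].
Qed.

(** Powers are iterated products, so a principal inner block of a longer power can be pulled out as
    a scalar. *)
Lemma iter_ideal_mul_scale (a : algC) (I J : set algC) n :
  iter n (ideal_mul I) (scale_ideal a J) =
  scale_ideal a (iter n (ideal_mul I) J).
Proof.
elim: n => [//|n IH]; rewrite !iterS IH.
by rewrite -[X in ideal_mul X _]scale_ideal1 ideal_mul_scale mul1r.
Qed.

Lemma principal_pow (I : set algC) k (a : algC) u :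
  I ^^ k = scale_ideal a O -> I ^^ (u * k) = scale_ideal (a ^+ u) O.
Proof.
move=> Ik; elim: u => [|u IH]; first by rewrite mul0n expr0 scale_ideal1.
by rewrite mulSnr iterD Ik iter_ideal_mul_scale IH scale_idealA exprS.
Qed.

(** Bezout in the form [u * k = v * m + gcdn k m] keeps all exponents nonnegative, and
    [a ^+ u / b ^+ v] generates the power. This replaces an exponent by a divisor of [m]. *)
Lemma principal_gcd (I : set algC) (k m : nat) (a b : algC) : (0 < k)%N ->
  K a -> K b -> a != 0 -> b != 0 ->
  I ^^ k = scale_ideal a O -> I ^^ m = scale_ideal b O ->
  exists c, [/\ K c, c != 0 & I ^^ (gcdn k m) = scale_ideal c O].
Proof.
move=> k0 Ka Kb a0 b0 Ik Im; case: (egcdnP m k0) => u v uv _.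
have := principal_pow _ _ _ u Ik; rewrite uv addnC iterD.
rewrite (principal_pow _ _ _ v Im) iter_ideal_mul_scale => /scale_ideal_eq.
rewrite expf_neq0 // => /(_ isT) ->; exists (a ^+ u / b ^+ v).
rewrite mulf_neq0 ?invr_eq0 ?expf_neq0 //; split=> //.
by apply: QsqrtM; [|apply: QsqrtV]; exact: QsqrtX.
Qed.

Lemma principal_associate (a b : algC) : a != 0 -> b != 0 ->
  scale_ideal a O = scale_ideal b O ->
  exists z, [/\ z != 0, O z, O z^-1 & b = z * a].
Proof.
move=> a0 b0 ab; exists (b / a).
have [r Or rE] : scale_ideal a O b.
  by rewrite ab; exists 1; [exact: intring1|rewrite mulr1].
have [r' Or' r'E] : scale_ideal b O a.
  by rewrite -ab; exists 1; [exact: intring1|rewrite mulr1].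
rewrite mulf_neq0 ?invr_eq0 // mulfVK //; split=> //.
  by rewrite -rE mulrC mulKf.
by rewrite invfM invrK mulrC -r'E mulrC mulKf.
Qed.

(** * Products and powers of ideals, and ideals with two generators *)

Lemma ideal_mul_mem (I J : set algC) u v : I u -> J v -> ideal_mul I J (u * v).
Proof.
move=> Iu Jv; exists 1%N, (fun=> u), (fun=> v); split=> //.
by rewrite big_ord1.
Qed.

Lemma ideal_mulD (I J : set algC) u v :
  ideal_mul I J u -> ideal_mul I J v -> ideal_mul I J (u + v).
Proof.
move=> [n [a [b [Ia Jb ->]]]] [n' [a' [b' [Ia' Jb' ->]]]].
(* The two finite families are concatenated, so that the sum of two sums is again a single sum of
   products. *)
pose glue (f : 'I_n -> algC) (f' : 'I_n' -> algC) (i : 'I_(n + n')) :=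
  match fintype.split i with inl j => f j | inr j => f' j end.
exists (n + n')%N, (glue a a'), (glue b b'); split.
- by move=> i; rewrite /glue; case: fintype.split.
- by move=> i; rewrite /glue; case: fintype.split.
- rewrite big_split_ord /=; congr (_ + _); apply: eq_bigr => i _; rewrite /glue.
    by rewrite (unsplitK (inl _ i)).
  by rewrite (unsplitK (inr _ i)).
Qed.

Lemma ideal_mulZ (I J : set algC) a u : (forall v, J v -> J (a * v)) ->
  ideal_mul I J u -> ideal_mul I J (a * u).
Proof.
move=> Ja [n [b [c [Ib Jc ->]]]]; exists n, b, (fun i => a * c i); split=> //.
  by move=> i; exact: Ja.
by rewrite mulr_sumr; apply: eq_bigr => i _; rewrite mulrCA.
Qed.

Lemma ideal_powZ (I : set algC) n a u :
  O a -> (I ^^ n) u -> (I ^^ n) (a * u).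
Proof.
move=> Oa; elim: n u => [u|n IH u]; first exact: intringM.
exact: ideal_mulZ.
Qed.

Lemma ideal_powD (I : set algC) n u v :
  (I ^^ n) u -> (I ^^ n) v -> (I ^^ n) (u + v).
Proof. by case: n => [|n]; [exact: intringD|exact: ideal_mulD]. Qed.

Lemma ideal_powX (I : set algC) n u : I u -> (I ^^ n) (u ^+ n).
Proof.
move=> Iu; elim: n => [|n IH]; first by rewrite expr0; exact: intring1.
by rewrite exprS; exact: ideal_mul_mem.
Qed.

Definition ideal2 (x y : algC) : set algC :=
  [set z | exists r t, [/\ O r, O t & z = x * r + y * t]].

Lemma ideal2D x y u v : ideal2 x y u -> ideal2 x y v -> ideal2 x y (u + v).
Proof.
move=> [r [t [Or Ot ->]]] [r' [t' [Or' Ot' ->]]].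
by exists (r + r'), (t + t'); split; [exact: intringD|exact: intringD|ring].
Qed.

Lemma ideal2Z x y a u : O a -> ideal2 x y u -> ideal2 x y (a * u).
Proof.
move=> Oa [r [t [Or Ot ->]]].
by exists (a * r), (a * t); split; [exact: intringM|exact: intringM|ring].
Qed.

Lemma ideal2_sub x y : O x -> O y -> ideal2 x y `<=` O.
Proof.
move=> Ox Oy _ [r [t [Or Ot ->]]].
by apply: intringD; exact: intringM.
Qed.

Lemma ideal2_l x y : ideal2 x y x.
Proof.
exists 1, 0; split; [exact: intring1|exact: intring0|].
by rewrite mulr1 mulr0 addr0.
Qed.

Lemma ideal2_r x y : ideal2 x y y.
Proof.
exists 0, 1; split; [exact: intring0|exact: intring1|].
by rewrite mulr1 mulr0 add0r.
Qed.

(** When a product of [n] elements [x * r + y * t] is expanded, every term without a factor [y]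
    contains [x ^+ n]. *)
Lemma ideal2_pow_sub x y n : O x -> O y ->
  ideal2 x y ^^ n `<=` ideal2 (x ^+ n) y.
Proof.
move=> Ox Oy; elim: n => [|n IH] z.
  move=> Oz; exists z, 0; rewrite expr0 mul1r mulr0 addr0.
  by split=> //; exact: intring0.
move=> [k [u [v [Iu /(_ _)/IH Jv ->]]]].
apply: (big_ind (ideal2 (x ^+ n.+1) y)).
- by exists 0, 0; rewrite !mulr0 addr0; split=> //; exact: intring0.
- exact: ideal2D.
- move=> i _; have [r [t [Or Ot ->]]] := Iu i.
  have [p [q [Op Oq ->]]] := Jv i.
  exists (r * p), (t * (x ^+ n * p + y * q) + x * r * q); split.
  + exact: intringM.
  + have Oxn := intringX _ n Ox.
    by do !(apply: intringD || apply: intringM).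
  + by rewrite exprS; ring.
Qed.

(** The [m]-th power lies in the ideal of [x ^+ m] and [y], which is that of [y] because [y] divides
    [x ^+ m]. Conversely [y ^+ m.-1] and [y'] are comaximal, so [y] is a combination of [y ^+ m] and
    [y * y' = x ^+ m], both in the power. *)
Lemma ideal2_powE x y y' m a b : (0 < m)%N -> O x -> O y -> O y' ->
  O a -> O b -> y * y' = x ^+ m -> a * y + b * y' = 1 ->
  ideal2 x y ^^ m = scale_ideal y O.
Proof.
move=> m0 Ox Oy Oy' Oa Ob yy' ab1.
(* Inserting [1 = a * y + b * y'] into [y ^+ n * p] raises the exponent of [y] by one. *)
have comax n : exists p q, [/\ O p, O q & y ^+ n * p + y' * q = 1].
  elim: n => [|n [p [q [Op Oq pq]]]].
    exists 1, 0; rewrite expr0 mulr1 mulr0 addr0.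
    by split=> //; [exact: intring1|exact: intring0].
  exists (p * a), (y ^+ n * p * b + q).
  have Oyn := intringX _ n Oy.
  split; [exact: intringM|by do !(apply: intringD || apply: intringM)|].
  rewrite -[RHS]pq -[y ^+ n * p in RHS]mulr1 -ab1 exprS; ring.
apply/seteqP; split => z.
  move=> /ideal2_pow_sub[] // r [t [Or Ot ->]].
  exists (y' * r + t); last by rewrite mulrDr mulrA yy'.
  by apply: intringD => //; exact: intringM.
move=> [w Ow <-]; have [p [q [Op Oq pq]]] := comax m.-1.
have -> : y * w = w * p * y ^+ m + w * q * x ^+ m.
  rewrite -yy' -[in y ^+ m](prednK m0) exprS -[y in LHS]mulr1 -pq; ring.
apply: ideal_powD; apply: ideal_powZ; rewrite ?intringM //.
- exact: intringM.
- by apply: ideal_powX; exact: ideal2_r.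
- exact: intringM.
- by apply: ideal_powX; exact: ideal2_l.
Qed.

Lemma ideal2_fractional x y : O x -> O y -> y != 0 ->
  fractional_ideal K (ideal2 x y).
Proof.
move=> Ox Oy y0; split.
- by move=> z /(ideal2_sub _ _ Ox Oy)[].
- by exists y => //; exact: ideal2_r.
- move=> u v Iu Iv; apply: ideal2D => //; rewrite -mulN1r.
  by apply: ideal2Z => //; apply: intringN; exact: intring1.
- exact: ideal2Z.
- exists 1; split; [exact: intring1|exact: oner_neq0|].
  by move=> z /(ideal2_sub _ _ Ox Oy); rewrite mul1r.
Qed.

(** * Traces bounded by norms, and division with remainder *)

Lemma trace_sqr_le (z : algC) (t n : int) :
  z + z^* = t%:~R -> z * z^* = n%:~R -> t ^+ 2 <= 4 * n.
Proof.
move=> tE nE; have := mul_conjC_ge0 (z - z^*).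
(* The squared modulus of twice the imaginary part is minus the discriminant of the polynomial with
   trace [t] and norm [n]. *)
have -> : (z - z^*) * (z - z^*)^* = (4 * n - t ^+ 2)%:~R.
  by rewrite rmorphB /= conjCK !(rmorphB, rmorphM, rmorphXn) /= -tE -nE; ring.
by rewrite ler0z subr_ge0.
Qed.

Lemma trace_sqr_lt (z : algC) (t n : int) : z^* != z ->
  z + z^* = t%:~R -> z * z^* = n%:~R -> t ^+ 2 < 4 * n.
Proof.
move=> zz' tE nE; rewrite lt_neqAle (trace_sqr_le z) // andbT.
have : (z - z^*) * (z - z^*)^* != 0 by rewrite mul_conjC_eq0 subr_eq0 eq_sym.
have -> : (z - z^*) * (z - z^*)^* = (4 * n - t ^+ 2)%:~R.
  by rewrite rmorphB /= conjCK !(rmorphB, rmorphM, rmorphXn) /= -tE -nE; ring.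
by rewrite intr_eq0 subr_eq0 eq_sym.
Qed.

Lemma nearest_int (a : rat) : exists k : int, `|a - k%:~R| <= 2^-1.
Proof.
exists (Num.floor (a + 2^-1)).
have /andP[] := floor_itv (a + 2^-1); rewrite ler_norml intrD => h1 h2.
by apply/andP; split; lra.
Qed.

(** A nonreal [zeta] has a nonzero coordinate [q] along the square root, so the change of basis can
    be inverted. *)
Lemma Qsqrt_basis (zeta z : algC) : zeta^* != zeta -> K zeta -> K z ->
  exists a b : rat, z = ratr a + ratr b * zeta.
Proof.
move=> nR [p [q zE]] [a [b ->]].
have q0 : q != 0.
  apply: contra_neq nR => q0.
  by rewrite zE q0 rmorph0 mul0r addr0 conj_ratr.
exists (a - b / q * p), (b / q); rewrite zE.
have -> : ratr b = ratr (b / q) * ratr q :> algC.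
  by rewrite -(rmorphM (ratr : rat -> algC)) divfK.
move: (b / q) => c; rewrite !(rmorphB, rmorphM) /=; ring.
Qed.

(* Such a [zeta] exists only in Q(i) and Q(sqrt(-3)): reducing coordinates
   modulo Z[zeta] leaves remainders of norm at most 3/4. *)
Lemma nonreal_unit_principal (zeta : algC) (I : set algC) :
  O zeta -> zeta * zeta^* = 1 -> zeta^* != zeta ->
  I `<=` O -> (exists2 x, I x & x != 0) ->
  (forall u v, I u -> I v -> I (u - v)) ->
  (forall a u, O a -> I u -> I (a * u)) ->
  exists b, [/\ O b, b != 0 & I = scale_ideal b O].
Proof.
move=> Oz zz nR IO [x0 Ix0 x00] IB IZ.
(* A nonzero element [b] of [I] of least norm will be the generator: a nonzero remainder modulo [b]
   would have smaller norm. *)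
pose P n := `[< exists z, [/\ I z, z != 0 & z * z^* = n%:R] >].
have exP : exists n, P n.
  have [n nE] := intring_norm _ (IO _ Ix0).
  by exists n; apply/asboolP; exists x0.
case: (ex_minnP exP) => n /asboolP[b [Ib b0 bn]] minn.
exists b; split=> //; first exact: IO.
apply/seteqP; split => [w Iw|_ [w Ow <-]]; last by rewrite mulrC; exact: IZ.
have Kdiv : K (w / b).
  by apply: QsqrtM; [case: (IO _ Iw)|apply: QsqrtV; case: (IO _ Ib)].
have [p [q pqE]] := Qsqrt_basis _ _ nR Oz.1 Kdiv.
have [[A hA] [B hB]] := (nearest_int p, nearest_int q).
pose g : algC := A%:~R + B%:~R * zeta.
have Og : O g.
  apply: intringD; first exact: intring_int.
  by apply: intringM => //; exact: intring_int.
have [r0|r0] := eqVneq (w - g * b) 0.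
  by exists g => //; rewrite mulrC; apply/esym/eqP; rewrite -subr_eq0 r0.
have Ir : I (w - g * b) by apply: IB => //; exact: IZ.
have [n' n'E] := intring_norm _ (IO _ Ir).
have : (n <= n')%N by apply: minn; apply/asboolP; exists (w - g * b).
have [t tE] := intring_trace _ Oz.
have t4 : t ^+ 2 < 4 * 1 by exact: (trace_sqr_lt zeta t 1).
have rE : w - g * b = (ratr (p - A%:~R) + ratr (q - B%:~R) * zeta) * b.
  rewrite -[w](divfK b0) pqE /g !rmorphB /= !ratr_int; ring.
have bn0 : 0 < n%:R :> algC by rewrite -bn mul_conjC_gt0.
(* The norm is multiplicative, so the remainder has the norm of [b] times the binary form at the two
   rounding errors. *)
have nE' : n'%:R = ratr ((p - A%:~R) ^+ 2 + t%:~R * (p - A%:~R) * (q - B%:~R)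
   + (q - B%:~R) ^+ 2) * n%:R :> algC.
  rewrite -n'E rE -bn; move: (p - _) (q - _) => e f.
  have -> : ((ratr e + ratr f * zeta) * b)^* =
      (ratr e + ratr f * zeta^*) * b^*.
    rewrite rmorphM; congr (_ * _).
    by rewrite rmorphD /= conj_ratr [X in _ + X]rmorphM /= conj_ratr.
  rewrite !(rmorphD, rmorphM, rmorphXn) /= ratr_int -tE.
  rewrite [X in _ = X](_ : _ = (ratr e ^+ 2 + (zeta + zeta^*) * ratr e * ratr f
    + ratr f ^+ 2 * (zeta * zeta^*)) * (b * b^*)); first by ring.
  by rewrite zz mulr1.
rewrite leqNgt => /negP; case.
rewrite -(ltr_nat algC) nE' gtr_pMl // -(rmorph1 (ratr : rat -> algC)) ltr_rat.
(* The integer [t] satisfies [t ^+ 2 < 4], because [zeta] is nonreal of norm 1. *)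
have t1 : `|t| <= 1.
  rewrite leNgt; apply/negP => t2; have {}t2 : 2 <= `|t| by lia.
  move: t4; rewrite -real_normK ?num_real // expr2 ltNge => /negP; apply.
  by apply: le_trans (ler_pM _ _ t2 t2).
move: hA hB; move: (p - _) (q - _) => e f he hf.
apply: binary_form_lt1 => //.
by rewrite -intr_norm -[1]/(1%:~R) ler_int.
Qed.

(** * The ideal of [x] and [th], and its principal powers *)

Section PowerOfIdeal.

Variables (x y : int) (m : nat).
Hypotheses (m_gt1 : (1 < m)%N) (dE : d = y ^+ 2 - 4 * x ^+ m).
Hypothesis xy1 : gcdz x y = 1.

(** A root of X^2 - y X + x^m, whose discriminant is [d]. *)
Let th : algC := (y%:~R + s) / 2.
Let I := ideal2 x%:~R th.

Lemma theta_trace : th + th^* = y%:~R.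
Proof.
rewrite /th rmorphM rmorphD /= conj_sqrtd fmorphV /= rmorph_int rmorph_nat.
by field.
Qed.

Lemma theta_norm : th * th^* = x%:~R ^+ m.
Proof.
rewrite /th rmorphM rmorphD /= conj_sqrtd fmorphV /= rmorph_int rmorph_nat.
have -> : x%:~R ^+ m = (y%:~R ^+ 2 - d%:~R) / 4 :> algC.
  by rewrite dE !(rmorphB, rmorphM, rmorphXn) /=; field.
by have := sqr_sqrtd; move: s => t <-; field.
Qed.

Lemma intring_theta : O th.
Proof.
split.
  exists (y%:~R / 2), 2^-1.
  by rewrite rmorphM !fmorphV /= ratr_int rmorph_nat /th; ring.
have pE : Poly [:: x%:~R ^+ m; - y%:~R; 1] =
    [:: x%:~R ^+ m; - y%:~R; 1] :> seq algC.
  by apply: (@PolyK _ 0); exact: oner_neq0.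
apply: (@root_monic_Aint (Poly [:: x%:~R ^+ m; - y%:~R; 1])).
- rewrite rootE horner_Poly /= -theta_norm -theta_trace; apply/eqP; ring.
- by rewrite monicE lead_coefE pE.
- apply/polyOverP => i; rewrite pE.
  by case: i => [|[|[|i]]] /=;
    rewrite ?rpredX ?rpredN ?rpred1 ?nth_nil ?rpred0 ?intr_int.
Qed.

Lemma x_neq0 : x != 0.
Proof.
apply/eqP => x0; move: d_lt0; rewrite dE x0 expr0n (gtn_eqF (ltnW m_gt1)) mulr0.
by rewrite subr0 ltNge sqr_ge0.
Qed.

Lemma theta_neq0 : th != 0.
Proof.
apply/eqP => th0; have /eqP := theta_norm.
by rewrite th0 mul0r eq_sym expf_eq0 intr_eq0 (negPf x_neq0) andbF.
Qed.

(** A Bezout relation between [x ^+ m] and [y] becomes the required one once these are written as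
    norm and trace of [th]. *)
Lemma theta_comaximal : exists a b, [/\ O a, O b & a * th + b * th^* = 1].
Proof.
have [u [v uv]] : exists u v : int, u * x ^+ m + v * y = 1.
  have : coprimez (x ^+ m) y by rewrite coprimezXl // /coprimez xy1.
  by move=> /coprimezP[[u v] /= uv]; exists u, v.
exists (u%:~R * th^* + v%:~R), v%:~R; split.
- apply: intringD; last exact: intring_int.
  apply: intringM; first exact: intring_int.
  by apply: intring_conj; exact: intring_theta.
- exact: intring_int.
- have uvC : u%:~R * x%:~R ^+ m + v%:~R * y%:~R = 1 :> algC.
    by rewrite -rmorphXn -!rmorphM -rmorphD uv.
  by rewrite -[RHS]uvC -theta_norm -theta_trace; ring.
Qed.

Lemma theta_ideal_pow : I ^^ m = scale_ideal th O.
Proof.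
have [a [b [Oa Ob ab]]] := theta_comaximal.
apply: (ideal2_powE _ _ (th^*) _ a b) => //.
- exact: ltnW.
- exact: intring_int.
- exact: intring_theta.
- by apply: intring_conj; exact: intring_theta.
- exact: theta_norm.
Qed.

(** Both [th] and [a ^+ (m %/ k)] generate the [m]-th power of [I], so they differ by a unit [z],
    which has norm 1. Taking norms then determines that of [a]. *)
Lemma principal_theta_ideal_pow k a : (0 < k)%N -> (k %| m)%N ->
  K a -> a != 0 -> I ^^ k = scale_ideal a O ->
  exists z, [/\ O z, z * z^* = 1, th = z * a ^+ (m %/ k), O a
    & a * a^* = `|x|%:~R ^+ k].
Proof.
move=> k0 km Ka a0 Ik.
have := principal_pow _ _ _ (m %/ k) Ik.
rewrite divnK // theta_ideal_pow => /esym aE.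
have [|z [z0 Oz OzV thE]] := principal_associate _ _ _ theta_neq0 aE.
  exact: expf_neq0.
have zz := intring_unit_norm _ z0 Oz OzV.
exists z; split=> //.
  have Ix := intring_int x.
  have : (I ^^ k) a by rewrite Ik; exists 1; [exact: intring1|rewrite mulr1].
  move=> /(ideal2_pow_sub _ _ _ Ix intring_theta).
  by apply: ideal2_sub; [exact: intringX|exact: intring_theta].
have e0 : (0 < m %/ k)%N by rewrite divn_gt0 // dvdn_leq // ltnW.
(* Both sides are nonnegative, so it suffices to compare their powers of exponent [m %/ k]. *)
apply: (@pexpIrn _ (m %/ k)%N) => //.
- by rewrite nnegrE mul_conjC_ge0.
- by rewrite nnegrE exprn_ge0 // ler0z.
rewrite -exprM mulnC divnK // exprMn -rmorphXn /=.
(* Here [x] may be negative, but [x ^+ m] is a norm and hence equals its absolute value. *)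
rewrite intr_norm -normrX -theta_norm ger0_norm ?mul_conjC_ge0 // thE rmorphM.
by rewrite mulrACA zz mul1r.
Qed.

Lemma no_class_of_order : ~ has_class_of_order K m ->
  exists e k z a, [/\ (1 < e)%N, (e * k = m)%N, O z /\ O a, z * z^* = 1
    & [/\ a * a^* = `|x|%:~R ^+ k,
          y%:~R = z * a ^+ e + (z * a ^+ e)^* & z^* = z \/ k = 1%N]].
Proof.
move=> noc; have [Ix Ot] := (intring_int x, intring_theta).
have thK := Ot.1; have th0 := theta_neq0.
(* The class of [I] is killed by [m], so not having order [m] means that a smaller positive exponent
   kills it. *)
have : exists k, (0 < k < m)%N /\ class_exp K (ideal_class K I) k = class_one K.
  apply: contrapT => nok; apply: noc; exists (ideal_class K I).
    by exists I => //; exact: ideal2_fractional.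
  split; first exact: ltnW.
    rewrite class_exp_ideal; apply/ideal_class_oneP; exists th.
    by split=> //; exact: theta_ideal_pow.
  by move=> k km kE; apply: nok; exists k.
move=> [k0 [/andP[k0_gt0 k0m]]]; rewrite class_exp_ideal.
move=> /ideal_class_oneP[a0 [Ka0 a00 Ik0]].
have [a [Ka an0 Ik]] :=
  principal_gcd _ _ _ _ _ k0_gt0 Ka0 thK a00 th0 Ik0 theta_ideal_pow.
set k := gcdn k0 m in Ik; have km : (k %| m)%N := dvdn_gcdr _ _.
have k_gt0 : (0 < k)%N by rewrite gcdn_gt0 k0_gt0.
have k_ltm : (k < m)%N.
  by apply: leq_ltn_trans k0m; rewrite dvdn_leq // dvdn_gcdl.
have [z [Oz zz thE Oa aa]] := principal_theta_ideal_pow _ _ k_gt0 km Ka an0 Ik.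
have [zR|zNR] := eqVneq (z^*) z.
  exists (m %/ k)%N, k, z, a; rewrite divnK // -thE theta_trace.
  by split=> //; [rewrite ltn_divRL // mul1n|split=> //; left].
(* With a nonreal unit [z] every nonzero ideal is principal, so the factorization can be redone with
   [k = 1], for a new unit [w], real or not. *)
have Ith : I th by exact: ideal2_r.
have [b [Ob b0 IE]] : exists b, [/\ O b, b != 0 & I = scale_ideal b O].
  apply: (nonreal_unit_principal z) => //.
  - exact: ideal2_sub.
  - by exists th.
  - move=> u v Iu Iv; apply: ideal2D => //; rewrite -mulN1r.
    by apply: ideal2Z => //; apply: intringN; exact: intring1.
  - exact: ideal2Z.
(* By definition [I ^^ 1] is the product of [I] and [O], so this needs that [O] times itself is
   [O]. *)
have I1 : I ^^ 1 = scale_ideal b O.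
  rewrite /= IE -[X in ideal_mul _ X]scale_ideal1 ideal_mul_scale mulr1.
  congr scale_ideal; apply/seteqP; split.
    move=> _ [n [u [v [Ou Ov ->]]]]; apply: (big_ind O).
    - exact: intring0.
    - exact: intringD.
    - by move=> i _; exact: intringM.
  by move=> w Ow; rewrite -[w]mul1r; apply: ideal_mul_mem => //; exact: intring1.
have [w [Ow ww thE' _ bb]] :=
  principal_theta_ideal_pow 1 _ isT (dvd1n m) Ob.1 b0 I1.
rewrite divn1 in thE'.
exists m, 1%N, w, b; rewrite muln1 -thE' theta_trace.
by split=> //; split=> //; right.
Qed.

End PowerOfIdeal.

End ImaginaryQuadratic.
(** * Counting exceptional pairs *)

(** A covering list may contain repetitions and extra elements, so bounds pass directly to subsets,
    images and unions. *)
Definition at_most {T : eqType} (n : nat) (A : set T) : Prop :=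
  exists s : seq T, (size s <= n)%N /\ forall t, A t -> t \in s.

Lemma at_most_sub {T : eqType} {n n' : nat} {A B : set T} :
  (n <= n')%N -> A `<=` B -> at_most n B -> at_most n' A.
Proof.
move=> nn' AB [s [sn sB]]; exists s; split; first exact: leq_trans nn'.
by move=> t /AB/sB.
Qed.

Lemma at_most_image {T U : eqType} {n : nat} {A : set T} (f : T -> U) :
  at_most n A -> at_most n (f @` A).
Proof.
move=> [s [sn sA]]; exists [seq f t | t <- s]; rewrite size_map; split=> //.
by move=> _ [t At <-]; apply: map_f; exact: sA.
Qed.

Lemma at_most_image2 {T U V : eqType} {n n' : nat} {A : set T} {B : set U}
    (f : T -> U -> V) : at_most n A -> at_most n' B ->
  at_most (n * n') [set v | exists t u, [/\ A t, B u & v = f t u]].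
Proof.
move=> [s [sn sA]] [s' [sn' sB]]; exists [seq f t u | t <- s, u <- s'].
rewrite size_allpairs leq_mul //; split=> // _ [t [u [At Bu ->]]].
by apply: allpairs_f; [exact: sA|exact: sB].
Qed.

Lemma at_most_setU {T : eqType} {n n' : nat} {A B : set T} :
  at_most n A -> at_most n' B -> at_most (n + n') (A `|` B).
Proof.
move=> [s [sn sA]] [s' [sn' sB]]; exists (s ++ s').
rewrite size_cat leq_add //; split=> // t [/sA|/sB]; rewrite mem_cat => -> //.
by rewrite orbT.
Qed.

Lemma at_most_bigcup {I T : eqType} (r : seq I) {n : nat} (A : I -> set T) :
  (forall i, at_most n (A i)) ->
  at_most (size r * n) [set t | exists2 i, i \in r & A i t].
Proof.
move=> An; elim: r => [|i r IH]; first by exists [::]; split=> // t [].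
apply: at_most_sub (at_most_setU (An i) IH); first by rewrite mulSn.
move=> t [j]; rewrite inE => /orP[/eqP ->|jr] Aj; [by left|by right; exists j].
Qed.

Lemma at_most_card {T : choiceType} {n : nat} {A : set T} :
  finite_set A -> at_most n A -> (#|` fset_set A| <= n)%N.
Proof.
move=> Afin [s [sn sA]]; apply: leq_trans sn.
apply: uniq_leq_size; first exact: fset_uniq.
by move=> t; rewrite in_fset_set // inE => /sA.
Qed.

Lemma at_most_int_ball (c : int) (M : nat) :
  at_most (2 * M) [set t : int | `|t - c| < M%:Z].
Proof.
exists [seq c - M%:Z + k%:Z | k <- iota 0 (2 * M)]; rewrite size_map size_iota.
split=> // t /=; rewrite ltr_norml => /andP[h1 h2]; apply/mapP.
by exists (absz (t - c + M%:Z)); rewrite ?mem_iota; lia.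
Qed.

(* A product of at least two factors that is smaller than [M ^ 2] has a factor
   smaller than [M]. *)
Lemma at_most_poly_small (p : {poly algC}) (M : nat) :
  p \is monic -> (2 < size p)%N ->
  at_most (size p * (4 * M)) [set t : int | `|p.[t%:~R]| < (M ^ 2)%:R].
Proof.
move=> pmon p2; have [r pE] := closed_field_poly_normal p.
rewrite (monicP pmon) scale1r in pE.
have sp : size p = (size r).+1 by rewrite pE size_prod_XsubC.
pose A (z : algC) := [set t : int | `|t%:~R - z| < M%:R].
have An z : at_most (4 * M) (A z).
  (* The root [z] need not be an integer. Recentring at an integer [t0] of [A z] doubles the radius,
     whence the bound [4 * M]. *)
  have [[t0 At0]|noA] := pselect (exists t0, A z t0); last first.
    by exists [::]; split=> // t At; case: noA; exists t.
  apply: at_most_sub (at_most_int_ball t0 (2 * M)); first by rewrite mulnA.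
  move=> t At /=; rewrite -(ltr_int algC) intr_norm rmorphB /=.
  have -> : t%:~R - t0%:~R = (t%:~R - z) - (t0%:~R - z) by ring.
  apply: le_lt_trans (ler_normB _ _) _.
  by rewrite mul2n -addnn PoszD rmorphD; exact: ltrD.
apply: at_most_sub (at_most_bigcup r A An).
  by rewrite leq_mul2r sp leqnSn orbT.
move=> t /= pt; apply: contrapT => nor.
move: pt; rewrite pE horner_prod normr_prod real_ltNge ?realn -?normr_prod //.
rewrite normr_prod => /negP; apply.
have Mle z : z \in r -> M%:R <= `|t%:~R - z|.
  move=> zr; rewrite real_leNgt ?realn ?normr_real //; apply/negP => tz.
  by apply: nor; exists z.
rewrite [leRHS](_ : _ = \prod_(z <- r) `|t%:~R - z|); last first.
  by apply: eq_bigr => z _; rewrite hornerXsubC.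
apply: (@le_trans _ _ (M%:R ^+ size r)).
  have r2 : (1 < size r)%N by rewrite -ltnS -sp.
  (* Powers of [M] grow with the exponent only for [M] at least 1; for [M = 0] both sides vanish. *)
  rewrite natrX; case: (M) => [|M']; last by rewrite ler_weXn2l // ler1n.
  by rewrite !expr0n ler0n.
elim: r Mle {pE sp nor A An} => [_|z r IH Mle]; first by rewrite big_nil.
rewrite big_cons exprS ler_pM ?exprn_ge0 ?Mle ?mem_head //.
by apply: IH => w wr; apply: Mle; rewrite inE wr orbT.
Qed.

(** * Dickson polynomials and quadratic integers of given norm *)

Fixpoint dickson (c : algC) (n : nat) : {poly algC} :=
  match n with
  | 0 => 2%:P
  | 1 => 'X
  | (n'.+1 as n1).+1 => 'X * dickson c n1 - c *: dickson c n'
  end.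

(** Power sums satisfy the same two-step recurrence, so the induction carries two consecutive
    indices. *)
Lemma horner_dickson (a b : algC) n :
  (dickson (a * b) n).[a + b] = a ^+ n + b ^+ n.
Proof.
suff [] : (dickson (a * b) n).[a + b] = a ^+ n + b ^+ n /\
    (dickson (a * b) n.+1).[a + b] = a ^+ n.+1 + b ^+ n.+1 by [].
elim: n => [|n [IH1 IH2]]; first by rewrite /= hornerC hornerX !expr0 !expr1.
split=> //; rewrite [dickson _ _]/= hornerD hornerN hornerZ hornerM hornerX.
by rewrite -/(dickson _ n.+1) IH1 IH2 !exprS; ring.
Qed.

(** The index starts at 1, since [dickson c 0] is the constant 2. The size bound at the previous
    index shows that the subtracted term leaves the leading one intact. *)
Lemma dickson_monic_size (c : algC) n :
  dickson c n.+1 \is monic /\ size (dickson c n.+1) = n.+2.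
Proof.
suff [] : (dickson c n.+1 \is monic /\ size (dickson c n.+1) = n.+2) /\
   (size (dickson c n) <= n.+1)%N by [].
elim: n => [|n [[mon sz] le]].
  by rewrite /= monicX size_polyX size_polyC; split=> //; case: eqP.
rewrite sz; split=> //.
have szX : size ('X * dickson c n.+1) = n.+3.
  by rewrite size_monicM ?monicX ?size_polyX ?sz // monic_neq0.
have lt : (size (- (c *: dickson c n))%R < size ('X * dickson c n.+1)%R)%N.
  rewrite szX size_polyN; apply: leq_ltn_trans (size_scale_leq _ _) _.
  exact: leqW.
rewrite [dickson _ n.+2]/= -/(dickson c n.+1) monicE.
rewrite lead_coefDl // size_polyDl //.
by rewrite szX lead_coefM lead_coefX mul1r -monicE.
Qed.

Definition quad_roots (u c : algC) : seq algC :=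
  [:: (u + sqrtC (u ^+ 2 - 4 * c)) / 2; (u - sqrtC (u ^+ 2 - 4 * c)) / 2].

(** The discriminant is the square of [a - b], so the chosen square root is [a - b] or its
    opposite. *)
Lemma mem_quad_roots (a b : algC) : a \in quad_roots (a + b) (a * b).
Proof.
have : (a - b) ^+ 2 == sqrtC ((a + b) ^+ 2 - 4 * (a * b)) ^+ 2.
  by rewrite sqrtCK; apply/eqP; ring.
rewrite eqf_sqr /quad_roots !inE => /orP[]/eqP <-; apply/orP; [left|right].
  by apply/eqP; field.
by rewrite -[X in _ - X]opprK -/(- _); apply/eqP; field.
Qed.

(** The trace [u] satisfies [u ^+ 2 <= 4 * c], hence [|u| < 2 * M]. This leaves at most [4 * M]
    traces, and trace and norm determine [a] up to two choices. *)
Lemma at_most_quadratic_integers (c : int) (M : nat) : c < (M ^ 2)%:Z ->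
  at_most (4 * M * 2) [set a : algC | a * a^* = c%:~R /\
    exists u : int, a + a^* = u%:~R].
Proof.
move=> cM; have [us [usn usP]] := at_most_int_ball 0 (2 * M).
apply: at_most_sub (@at_most_bigcup _ _ us 2
  (fun u : int => [set` quad_roots u%:~R c%:~R]) _).
- by rewrite leq_mul2r /= (leq_trans usn) // mulnA.
- move=> a [/= ac [u au]]; exists u; last by rewrite /= -ac -au mem_quad_roots.
  apply: usP => /=; rewrite subr0.
  have := trace_sqr_le _ _ _ au ac.
  rewrite -real_normK ?num_real // => uc; rewrite ltNge; apply/negP => hu.
  have := ler_pM _ _ hu hu => /(_ isT isT); rewrite -expr2 => h.
  by have := le_trans h uc; move: cM; rewrite -mulnn; lia.
- by move=> u; exists (quad_roots u%:~R c%:~R).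
Qed.

(** A real [z] of norm 1 is a sign, so [y] is up to sign the Dickson polynomial at the trace of [a].
    The factor 2 counts signs, and [e.+1] is the size of the polynomial. *)
Lemma at_most_real_unit (c : int) (e M : nat) : (1 < e)%N ->
  at_most (2 * (e.+1 * (4 * M))) [set y : int | `|y| < (M ^ 2)%:Z /\
    exists z a : algC, [/\ z * z^* = 1, z^* = z, a * a^* = c%:~R,
      exists t : int, a + a^* = t%:~R &
      y%:~R = z * a ^+ e + (z * a ^+ e)^*]].
Proof.
case: e => [//|e] e1; have [mon sz] := dickson_monic_size c%:~R e.
have small := at_most_poly_small _ M mon.
rewrite sz in small; have {}small := small e1.
have signs : at_most 2 [set` [:: 1; -1] : seq int] by exists [:: 1; -1].
apply: at_most_sub (at_most_image2 (fun (w : int) (t : int) =>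
  w * Num.floor (dickson c%:~R e.+1).[t%:~R]) signs small) => //.
move=> y [ysmall [z [a [zz zR aa [t tE] yE]]]].
have [w wsign zw] : exists2 w : int, w \in [:: 1; -1] & z = w%:~R.
  move: zz; rewrite zR -expr2 => /eqP; rewrite sqrf_eq1 => /orP[]/eqP ->.
    by exists 1.
  by exists (-1); rewrite // rmorphN1.
have ww : w * w = 1.
  by move: wsign; rewrite !inE => /orP[]/eqP ->.
have DE : (dickson c%:~R e.+1).[t%:~R] = (w * y)%:~R.
  rewrite -aa -tE horner_dickson intrM yE [(z * _)^*]rmorphM /= zR rmorphXn /=.
  by rewrite -mulrDr mulrA zw -intrM ww mul1r.
exists w, t; split=> //=.
  rewrite DE -intr_norm [X in _ < X]pmulrn ltr_int normrM.
  by move: wsign; rewrite !inE => /orP[]/eqP ->; rewrite ?normrN1 ?normr1 mul1r.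
by rewrite DE intrKfloor mulrA ww mul1r.
Qed.

(** Here [y] is determined by the pair of [z] and [a], which are quadratic integers of norms 1 and
    [c]. The strict bound [1 < 2 ^ 2] gives the 16 candidates for [z]. *)
Lemma at_most_any_unit (c : int) (e M : nat) : c < (M ^ 2)%:Z ->
  at_most (4 * 2 * 2 * (4 * M * 2)) [set y : int |
    exists z a : algC, [/\ z * z^* = 1, exists t : int, z + z^* = t%:~R,
      a * a^* = c%:~R, exists t : int, a + a^* = t%:~R &
      y%:~R = z * a ^+ e + (z * a ^+ e)^*]].
Proof.
move=> cM; have units : (1 : int) < (2 ^ 2)%:Z by [].
apply: at_most_sub (at_most_image2
  (fun z a : algC => Num.floor (z * a ^+ e + (z * a ^+ e)^*))
  (at_most_quadratic_integers 1 2 units)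
  (at_most_quadratic_integers c M cM)) => //.
move=> y [z [a [zz zt aa at_ yE]]].
by exists z, a; split=> //; rewrite -yE intrKfloor.
Qed.

(** * Exceptional pairs with fixed [x], and the total count *)

Lemma exceptional_fiber (m M N : nat) (x : int) : (1 < m)%N -> (N <= M ^ 2)%N ->
  at_most ((8 * m.+1 ^ 2 + 128) * M) [set y : int | exceptional m N (x, y)].
Proof.
move=> m1 NM; have [xN|xN] := ltP `|x| N%:Z; last first.
  by exists [::]; split=> // y [[/=]]; rewrite ltNge xN.
(* This is the case of a real unit, with [k] recovered as [m %/ e]. The condition on [e] makes [A e]
   empty outside the range, so one bound serves all [e]. *)
pose A e := [set y : int | [/\ (1 < e <= m)%N, `|y| < (M ^ 2)%:Z &
  exists z a : algC, [/\ z * z^* = 1, z^* = z,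
      a * a^* = (`|x| ^+ (m %/ e))%:~R, exists t : int, a + a^* = t%:~R &
      y%:~R = z * a ^+ e + (z * a ^+ e)^*]]].
have Ae e : at_most (2 * (m.+1 * (4 * M))) (A e).
  have [/andP[e1 em]|ne] := boolP (1 < e <= m)%N; last first.
    by exists [::]; split=> // y []; rewrite (negPf ne).
  apply: at_most_sub (at_most_real_unit (`|x| ^+ (m %/ e)) e M e1).
    by rewrite leq_mul2l leq_mul2r ltnS em orbT.
  by move=> y [_ ysmall yE].
have xM : `|x| < (M ^ 2)%:Z by apply: lt_le_trans xN _; rewrite lez_nat.
(* The [m.+1] sets [A e] contribute [8 * m.+1 ^ 2 * M]. The case [k = 1], where [a] has norm
   [|x| < M ^ 2], contributes [128 * M]. *)
apply: at_most_sub (at_most_setU (at_most_bigcup (iota 0 m.+1) A Ae)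
  (at_most_any_unit `|x| m M xM)).
  by rewrite size_iota -mulnn; nia.
move=> y [[/= _ yN d0 xy1] noc].
have [e [k [z [a [e1 ekm [Oz Oa] zz [aa yE zk]]]]]] :=
  no_class_of_order _ d0 _ _ _ m1 erefl xy1 noc.
have zt := intring_trace _ d0 _ Oz; have at_ := intring_trace _ d0 _ Oa.
case: zk => [zR|k1]; [left|right].
  have em : (e <= m)%N.
    rewrite -ekm leq_pmulr //; move: m1; rewrite -ekm.
    by case: (k) => //; rewrite muln0.
  exists e; first by rewrite inE mem_iota; lia.
  split; [by rewrite e1|by apply: lt_le_trans yN _; rewrite lez_nat|].
  have -> : (m %/ e)%N = k by rewrite -ekm mulKn // ltnW.
  by exists z, a; split=> //; rewrite rmorphXn.
exists z, a; split=> //; first by rewrite aa k1 expr1.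
by move: yE; rewrite -[in m]ekm k1 muln1 => <-.
Qed.

Lemma card_exceptional (m M N : nat) : (1 < m)%N -> (N <= M ^ 2)%N ->
  (#|` fset_set (exceptional m N)| <= 2 * N * ((8 * m.+1 ^ 2 + 128) * M))%N.
Proof.
move=> m1 NM; apply: at_most_card; first exact: finite_exceptional.
have [xs [xsn xsP]] := at_most_int_ball 0 N.
have fib x := at_most_image (pair x) (exceptional_fiber m M N x m1 NM).
apply: at_most_sub (at_most_bigcup xs _ fib).
  by rewrite leq_mul2r xsn orbT.
move=> [x y] E; exists x; last by exists y.
by apply: xsP => /=; rewrite subr0; case: E => -[].
Qed.

Theorem theorem5p4 (R : realType) (m : nat) (hm : (1 < m)%N) :
  (fun N : nat => #|` fset_set (exceptional m N)|%:R : R^o) =O_\oo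
  (fun N : nat => N%:R `^ (3 / 2) * ln N%:R : R^o).
Proof.
set C := (8 * m.+1 ^ 2 + 128)%N.
have ln2 : 0 < ln 2 :> R by rewrite ln_gt0 // ltr1n.
(* The count [2 * N * (C * M)] with [M] at most twice the square root of [N] gives [4 * C]. Dividing
   by [ln 2] absorbs the logarithm, as [ln N] is at least [ln 2]. *)
apply/eqO_exP; exists (4 * C%:R / ln 2).
  by rewrite divr_gt0 // mulr_gt0 // ltr0n /C; lia.
near=> N.
have N2 : (2 <= N)%N by near: N; exists 2%N.
have sqrt1 : 1 <= Num.sqrt N%:R :> R.
  by rewrite -[leLHS]sqrtr1 ler_wsqrtr // ler1n ltnW.
have /andP[tr1 tr2] := truncn_itv (sqrtr_ge0 (N%:R : R)).
(* Adding 1 to the truncated root ensures [N <= M ^ 2]; it at most doubles the bound because the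
   root is at least 1. *)
set M := (Num.truncn (Num.sqrt N%:R : R)).+1 in tr2.
have NM : (N <= M ^ 2)%N.
  rewrite -(ler_nat R) natrX -[leLHS]sqr_sqrtr //.
  by rewrite lerXn2r ?nnegrE ?sqrtr_ge0 // ltW.
have MS : M%:R <= 2 * Num.sqrt N%:R :> R by rewrite /M -natr1; lra.
have powE : N%:R `^ (3 / 2) = N%:R * Num.sqrt N%:R :> R.
  rewrite -powR12_sqrt // (_ : 3 / 2 = 1 + 2^-1 :> R); last by field.
  rewrite powRD ?powRr1 //; apply/implyP => _.
  by rewrite pnatr_eq0 -lt0n ltnW.
have lnN : ln 2 <= ln N%:R :> R.
  by rewrite ler_ln ?posrE ?ltr0n ?ler_nat // ltnW.
rewrite powE ger0_norm // ger0_norm; last first.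
  by rewrite !mulr_ge0 ?sqrtr_ge0 // (le_trans _ lnN) // ltW.
apply: (@le_trans _ _ (4 * C%:R * (N%:R * Num.sqrt N%:R))).
  apply: (@le_trans _ _ (2 * N * (C * M))%:R).
    by rewrite ler_nat; exact: card_exceptional.
  rewrite !natrM; have := ler_wpM2l _ MS => /(_ (2 * N%:R * C%:R)) h.
  have := h _; rewrite !mulr_ge0 // => /(_ isT); lra.
rewrite [leRHS](_ : _ = 4 * C%:R * (N%:R * Num.sqrt N%:R) * (ln N%:R / ln 2));
  last by ring.
rewrite ler_peMr ?mulr_ge0 ?sqrtr_ge0 //.
by rewrite ler_pdivlMr ?mul1r.
Unshelve. all: by end_near. Qed.
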